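(* Let $\Gamma$ be an infinite highly-arc-transitive connected digraph such that the in-valency and the out-valency are both equal to some prime $p$. Then either $\Gamma$ is two-ended or the subdigraph spanned by the descendant set of a vertex $v$ is a rooted tree with out-valency $p$ (for every vertex $v$).
   Context: A digraph $\Gamma=(V\Gamma,E\Gamma)$ has vertex set $V\Gamma$ and arc set $E\Gamma\subseteq V\Gamma\times V\Gamma$. It is connected if its underlying undirected graph is connected. The in-valency (out-valency) of a vertex $v$ is the number of vertices $u$ with $(u,v)\in E\Gamma$ (respectively $(v,u)\in E\Gamma$). A $k$-arc is a sequence of vertices $v_0,\dots,v_k$ with $(v_i,v_{i+1})\in E\Gamma$ for $0\le i<k$ (a 0-arc is a vertex). $\Gamma$ is highly-arc-transitive if $\mathrm{Aut}(\Gamma)$ is transitive on the $k$-arcs for all $k$. A ray is a one-way infinite path (in the underlying undirected graph) with distinct vertices. The ends of a digraph are the equivalence classes of rays, where two rays are equivalent if there is an infinite family of pairwise disjoint paths (ignoring directions) each having its initial vertex in one ray and terminal vertex in the other. A digraph is two-ended if it is connected and has exactly two ends. The descendant set of a vertex $v$ is the set of vertices $w$ such that for some $k\ge 0$ there is a $k$-arc with initial vertex $v$ and terminal vertex $w$ (so $v$ belongs to it). The subdigraph spanned by a set of vertices is the induced subdigraph. A rooted tree with out-valency $p$ here means a digraph whose underlying graph is a tree, with a root $v$, all arcs directed away from the root, and every vertex having out-valency $p$. *)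

(* Defs.v *)
From mathcomp Require Import all_boot.
From mathcomp Require Import boolp classical_sets functions cardinality.

Set Implicit Arguments.
Unset Strict Implicit.
Unset Printing Implicit Defensive.

Local Open Scope classical_set_scope.
Local Open Scope card_scope.

Record digraph := Digraph {
  vertex :> Type;
  arc : vertex -> vertex -> Prop
}.
Arguments arc : clear implicits.

Definition has_in_valency (G : digraph) (v : G) (d : nat) : Prop :=
  [set u | arc G u v] #= `I_d.

Definition has_out_valency (G : digraph) (v : G) (d : nat) : Prop :=
  [set u | arc G v u] #= `I_d.

Definition automorphism (G : digraph) (g : G -> G) :=
  bijective g /\ forall u v, arc G u v <-> arc G (g u) (g v).

Definition is_karc (G : digraph) (k : nat) (a : 'I_k.+1 -> G) :=
  forall i j : 'I_k.+1, j = i.+1 :> nat -> arc G (a i) (a j).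

Definition highly_arc_transitive (G : digraph) :=
  forall (k : nat) (a b : 'I_k.+1 -> G), is_karc a -> is_karc b ->
  exists2 g : G -> G, automorphism g & forall i, g (a i) = b i.

(* Adjacency in the underlying undirected graph. *)
Definition adj (G : digraph) (u v : G) := arc G u v \/ arc G v u.

(* A path with k edges in the underlying undirected graph; k = 0 is allowed. *)
Definition is_path (G : digraph) (k : nat) (a : 'I_k.+1 -> G) :=
  injective a /\ forall i j : 'I_k.+1, j = i.+1 :> nat -> adj (a i) (a j).

Definition connected (G : digraph) :=
  forall u v : G, exists (k : nat) (a : 'I_k.+1 -> G),
    [/\ is_path a, a ord0 = u & a ord_max = v].

Definition is_ray (G : digraph) (r : nat -> G) :=
  injective r /\ forall i, adj (r i) (r i.+1).

Definition ray_equiv (G : digraph) (r s : nat -> G) :=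
  exists (len : nat -> nat) (P : forall m, 'I_(len m).+1 -> G),
    (forall m, [/\ is_path (P m), range r (P m ord0)
                 & range s (P m ord_max)])
    /\ trivIset [set: nat] (fun m => range (P m)).

Definition ends (G : digraph) : set (set (nat -> G)) :=
  [set [set s | is_ray s /\ ray_equiv r s] | r in [set r : nat -> G | is_ray r]].

Arguments ends : clear implicits.

Definition two_ended (G : digraph) := connected G /\ ends G #= `I_2.

Definition descendants (G : digraph) (v : G) : set G :=
  [set w | exists (k : nat) (a : 'I_k.+1 -> G),
    [/\ is_karc a, a ord0 = v & a ord_max = w]].

Lemma descendants_refl (G : digraph) (v : G) : descendants v v.
Proof.
exists 0%N, (fun=> v); split=> // i j.
by rewrite [i]ord1 [j]ord1.
Qed.

Definition induced (G : digraph) (A : set G) : digraph :=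
  @Digraph {x : G | A x} (fun x y => arc G (sval x) (sval y)).

(* ordS is the successor modulo n, so the last vertex is adjacent to c 0. *)
Definition is_cycle (G : digraph) (n : nat) (c : 'I_n -> G) :=
  [/\ (2 < n)%N, injective c & forall i, adj (c i) (c (ordS i))].

(* adj does not exclude loops, hence the second clause; a pair of opposite arcs
   counts as a single edge here. *)
Definition underlying_tree (G : digraph) :=
  [/\ connected G, forall x : G, ~ arc G x x
    & forall n (c : 'I_n -> G), ~ is_cycle c].

(* An arc (x, y) is directed away from v when the path of the tree from v to y
   passes through x; in particular (y, x) is then not directed away from v. *)
Definition directed_away (G : digraph) (v : G) :=
  forall x y : G, arc G x y ->
  forall (k : nat) (a : 'I_k.+1 -> G),
    is_path a -> a ord0 = v -> a ord_max = y -> range a x.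

Definition rooted_tree (G : digraph) (v : G) (d : nat) : Prop :=
  [/\ underlying_tree G, directed_away v
    & forall x : G, has_out_valency x d].

Definition descendant_digraph (G : digraph) (v : G) : digraph :=
  induced (descendants v).

Definition descendant_root (G : digraph) (v : G) : descendant_digraph v :=
  exist _ v (descendants_refl v).

(* Main.v *)
Require Import Defs.
From mathcomp Require Import all_boot.
From mathcomp Require Import boolp classical_sets functions cardinality.
From mathcomp Require Import ssralg ssrnum ssrint zify.
(* [path.arc] would otherwise shadow the arc relation of digraphs. *)
Import Defs.

(** Let D_k(v) be the set of terminal vertices of the k-arcs starting at v. The
    sets D_k(v), k >= 0, are pairwise disjoint: otherwise two of them coincide,
    the descendant set of v is finite, and G is finite. By homogeneity every
    vertex of D_{k+1}(v) has the same number c_k of in-neighbours in D_k(v), so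
    that |D_k(v)| p = |D_{k+1}(v)| c_k; hence |D_k(v)| divides p^k, c_k is a
    power of p, and c_k is 1 or p. If c_k = 1 for all k, descendant sets are
    trees. If c_K = p, then c_k = p for all k >= K, and D_{K+1}(u) = D_K(v) for
    every arc (u, v) since both sets have the same size. Along a backward ray
    ..., v_{-1}, v_0 the set S_i = D_{i+j}(v_{-j}) then does not depend on j as
    soon as i + j >= K, and the finite sets S_i (i in Z) partition G with all
    arcs going from some S_i to S_{i+1}, so that G has two ends. *)

Set Implicit Arguments.
Unset Strict Implicit.
Unset Printing Implicit Defensive.

Local Open Scope classical_set_scope.
Local Open Scope card_scope.

(** * Counting in finite sets *)

Lemma card_enum (T : Type) (A : set T) n : A #= `I_n ->
  exists s : seq {classic T}, [/\ uniq s, size s = n & forall x, x \in s <-> A x].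
Proof.
move=> An; exists (finmap.enum_fset (fset_set (A : set {classic T}))); split.
- exact: finmap.fset_uniq.
- exact: card_fset_set.
- have fA : finite_set (A : set {classic T}) by apply/finite_setP; exists n.
  by move=> x; rewrite in_fset_set // inE.
Qed.

Lemma sub_card_eq (T : Type) (A B : set T) n :
  A `<=` B -> A #= `I_n -> B #= `I_n -> A = B.
Proof.
move=> AB /card_enum[s [us ss As]] /card_enum[t [ut st Bt]].
have st_sub : {subset s <= t} by move=> x /As/AB/Bt.
have [_ eq_st] := uniq_min_size us st_sub (eq_leq (etrans st (esym ss))).
by apply/seteqP; split=> // x /Bt; rewrite -eq_st => /As.
Qed.

Lemma finite_inj_self (T : Type) (f : T -> T) (A : set T) :
  injective f -> finite_set A -> f @` A `<=` A -> f @` A = A.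
Proof.
move=> f_inj /finite_setP[n An] fA.
apply: sub_card_eq fA _ (An).
by apply: card_eq_trans An; apply: inj_card_eq => x y _ _ /f_inj.
Qed.

(** Both products count the pairs of [A] and [B] related by [e], as a double sum of indicators. *)
Lemma double_count (T : Type) (e : T -> T -> Prop) (A B : set T) a b p c :
  A #= `I_a -> B #= `I_b ->
  (forall u, A u -> [set w | B w /\ e u w] #= `I_p) ->
  (forall w, B w -> [set u | A u /\ e u w] #= `I_c) ->
  a * p = b * c.
Proof.
have count_set (C : set T) (s : seq {classic T}) (P : T -> Prop) m :
    uniq s -> (forall x, x \in s <-> C x) -> [set x | C x /\ P x] #= `I_m ->
  \sum_(x <- s) `[< P x >] = m.
  move=> us Cs /card_enum[t [ut <- Pt]].
  rewrite -big_mkcond sum1_count -size_filter.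
  apply/perm_size/uniq_perm; rewrite ?filter_uniq // => x.
  rewrite mem_filter; apply/andP/idP => [[/asboolP Px /Cs Cx]|/Pt[/Cs Cx Px]].
    exact/Pt.
  by split=> //; apply/asboolP.
move=> /card_enum[s [us <- As]] /card_enum[t [ut <- Bt]] eA eB.
have {eA} <- : \sum_(u <- s) \sum_(w <- t) `[< e u w >] = size s * p.
  under eq_big_seq => u /As/eA/(count_set _ _ _ _ ut Bt) -> do over.
  by rewrite big_const_seq count_predT iter_addn_0 mulnC.
rewrite exchange_big /=.
under eq_big_seq => w /Bt/eB/(count_set _ _ (e^~ w) _ us As) -> do over.
by rewrite big_const_seq count_predT iter_addn_0 mulnC.
Qed.

(** * Directed and undirected walks *)

Fixpoint reach (G : digraph) (k : nat) (u w : G) : Prop :=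
  if k is k'.+1 then exists2 x, reach k' u x & arc G x w else u = w.

Lemma reach_trans (G : digraph) k l (u x w : G) :
  reach k u x -> reach l x w -> reach (k + l) u w.
Proof.
move=> ux; elim: l w => [w <-|l IH w [y /IH uy yw]]; first by rewrite addn0.
by rewrite addnS; exists y.
Qed.

Lemma reach_split (G : digraph) k l (u w : G) :
  reach (k + l) u w -> exists2 x, reach k u x & reach l x w.
Proof.
elim: l w => [|l IH] w; first by rewrite addn0 => uw; exists w.
by rewrite addnS => -[y /IH[x ux xy] yw]; exists x => //; exists y.
Qed.

Lemma reach1 (G : digraph) (u v : G) : arc G u v -> reach 1 u v.
Proof. by exists u. Qed.

Lemma reachSl (G : digraph) k (u v w : G) :
  arc G u v -> reach k v w -> reach k.+1 u w.
Proof. by move/reach1/reach_trans => H /H. Qed.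

Lemma reach_karc (G : digraph) k (u w : G) :
  reach k u w <-> exists a : 'I_k.+1 -> G,
    [/\ is_karc a, a ord0 = u & a ord_max = w].
Proof.
split=> [uw|[a [arca <- <-]]].
  suff [a [a0 ak arca]] : exists a : nat -> G, [/\ a 0 = u, a k = w &
      forall i, i < k -> arc G (a i) (a i.+1)].
    exists (fun i => a i); split=> // i j ji; rewrite ji.
    by apply: arca; rewrite -ltnS -ji.
  elim: k w uw => [w ->|k IH w [x /IH[a [a0 ak arca]] xw]].
    by exists (fun=> w).
  exists (fun i => if i <= k then a i else w); split; rewrite /= ?ltnn // => i.
  move=> ik1; have /predU1P[->|ik] : (i == k) || (i < k) by rewrite -leq_eqVlt.
    by rewrite leqnn ltnn ak.
  by rewrite ik (ltnW ik); apply: arca.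
have -> : ord_max = inord k :> 'I_k.+1 by apply/val_inj; rewrite /= inordK.
suff H i : i <= k -> reach i (a ord0) (a (inord i)) by exact: H.
elim: i => [_|i IH ik]; first by congr a; apply/val_inj; rewrite /= inordK.
exists (a (inord i)); first exact/IH/ltnW.
by apply: arca; rewrite !inordK // ltnS ltnW.
Qed.

Lemma automorphism_inj (G : digraph) (g : G -> G) : automorphism g -> injective g.
Proof. by move=> [/bij_inj]. Qed.

Lemma automorphism_reach (G : digraph) (g : G -> G) k (u w : G) :
  automorphism g -> reach k u w -> reach k (g u) (g w).
Proof.
case=> _ garc; elim: k w => [w -> //|k IH w [x /IH ux xw]].
by exists (g x); [exact: ux|exact: (garc x w).1].
Qed.

(** High arc-transitivity is only ever used in this form; [k = 0] gives vertex-transitivity. *)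
Lemma reach_homogeneous (G : digraph) k (u w u' w' : G) :
  highly_arc_transitive G -> reach k u w -> reach k u' w' ->
  exists g, [/\ automorphism g, g u = u' & g w = w'].
Proof.
move=> hat /reach_karc[a [arca <- <-]] /reach_karc[b [arcb <- <-]].
by have [g autg gab] := hat _ _ _ arca arcb; exists g.
Qed.

(** Repeated vertices are allowed, so that walks compose; [walk_path] recovers injective paths. The
    set [A] serves to confine a walk to a band of levels. *)
Inductive walk (G : digraph) (A : set G) (u : G) : G -> Prop :=
| walk_refl : A u -> walk A u u
| walk_step v w : walk A u v -> adj v w -> A w -> walk A u w.

Lemma adj_sym (G : digraph) (u v : G) : adj u v -> adj v u.
Proof. by case; [right|left]. Qed.

Lemma walkW (G : digraph) (A B : set G) (u v : G) :
  A `<=` B -> walk A u v -> walk B u v.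
Proof.
move=> AB; elim=> [/AB|x w _ uw xw /AB]; first exact: walk_refl.
exact: walk_step xw.
Qed.

Lemma walk_trans (G : digraph) (A : set G) (u v w : G) :
  walk A u v -> walk A v w -> walk A u w.
Proof. by move=> uv; elim=> // x y _; apply: walk_step. Qed.

Lemma walk_sym (G : digraph) (A : set G) (u v : G) : walk A u v -> walk A v u.
Proof.
elim=> [|x w ux xu xw Aw]; first exact: walk_refl.
apply: walk_trans xu.
apply: walk_step (adj_sym xw) _; first exact: walk_refl.
by elim: ux.
Qed.

Lemma walk_path (G : digraph) (A : set G) (u w : G) : walk A u w ->
  exists (k : nat) (a : 'I_k.+1 -> G),
    [/\ is_path a, a ord0 = u, a ord_max = w & forall i, A (a i)].
Proof.
suff /[apply] : walk A u w -> exists (k : nat) (a : nat -> G),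
    [/\ a 0 = u, a k = w, forall i j, i <= k -> j <= k -> a i = a j -> i = j,
      forall i, i < k -> adj (a i) (a i.+1) & forall i, i <= k -> A (a i)].
  move=> [k [a [a0 ak ainj aadj Aa]]].
  exists k, (fun i => a i); split=> // [|i]; last by apply: Aa; rewrite -ltnS.
  split=> [i j eq_ij|i j ji]; rewrite ?ji.
    by apply/val_inj; apply: ainj eq_ij; rewrite -ltnS.
  by apply: aadj; rewrite -ltnS -ji.
elim=> [Au|v x _ [k [a [a0 ak ainj aadj Aa]]] vx Ax].
  by exists 0, (fun=> u); split=> // -[|//] [|//].
(* Loop erasure: if the new vertex is already on the path, the path is cut there; otherwise it is
   extended. *)
have [[j jk ajx]|xa] := pselect (exists2 j, j <= k & a j = x).
  exists j, a; split=> // [i i' ij i'j|i ij|i ij].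
  - by apply: ainj; apply: leq_trans jk.
  - by apply: aadj; apply: leq_trans jk.
  - by apply: Aa; apply: leq_trans jk.
exists k.+1, (fun i => if i <= k then a i else x); split=> [//||i j|i|i _].
- by rewrite ltnn.
- rewrite [i <= _]leq_eqVlt [j <= _]leq_eqVlt !ltnS.
  move=> /predU1P[->|ik] /predU1P[->|jk]; rewrite ?ltnn ?ik ?jk //.
  + by move=> xaj; case: xa; exists j.
  + by move=> xai; case: xa; exists i.
  + exact: ainj.
- move=> ik1; have /predU1P[->|ik] : (i == k) || (i < k) by rewrite -leq_eqVlt.
    by rewrite leqnn ltnn ak.
  by rewrite ik (ltnW ik); apply: aadj.
- by case: ifP => // /Aa.
Qed.

Lemma connected_walk (G : digraph) (u v : G) : connected G -> walk setT u v.
Proof.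
move=> /(_ u v)[k [a [[_ aadj] <- <-]]].
have -> : ord_max = inord k :> 'I_k.+1 by apply/val_inj; rewrite /= inordK.
suff H i : i <= k -> walk setT (a ord0) (a (inord i)) by exact: H.
elim: i => [_|i IH ik].
  have -> : inord 0 = ord0 :> 'I_k.+1 by apply/val_inj; rewrite /= inordK.
  exact: walk_refl.
apply: walk_step (IH (ltnW ik)) _ _ => //.
by apply: aadj; rewrite !inordK // ltnS ltnW.
Qed.

(** * The levels of a descendant set *)

Lemma descendantsP (G : digraph) (v w : G) :
  descendants v w <-> exists k, reach k v w.
Proof.
split=> [[k [a Ha]]|[k /reach_karc[a Ha]]]; exists k; last by exists a.
by apply/reach_karc; exists a.
Qed.

Lemma descendants_arc (G : digraph) (v x y : G) :
  descendants v x -> arc G x y -> descendants v y.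
Proof. by move=> /descendantsP[k vx] xy; apply/descendantsP; exists k.+1, x. Qed.

Lemma descendants_trans (G : digraph) (u v w : G) :
  descendants u v -> descendants v w -> descendants u w.
Proof.
move=> /descendantsP[k uv] /descendantsP[l vw].
by apply/descendantsP; exists (k + l); apply: reach_trans vw.
Qed.

Lemma automorphism_descendants (G : digraph) (g : G -> G) (v w : G) :
  automorphism g -> descendants v w -> descendants (g v) (g w).
Proof.
move=> autg /descendantsP[k vw]; apply/descendantsP; exists k.
exact: automorphism_reach.
Qed.

(** An automorphism fixing [v] takes [w] to [x], and it carries the walk of length [l] along. *)
Lemma reach_exchange (G : digraph) k l (v w x : G) :
  highly_arc_transitive G ->
  reach k v w -> reach l v w -> reach k v x -> reach l v x.
Proof.
move=> hat vw vwl vx; have [g [autg gv <-]] := reach_homogeneous hat vw vx.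
by rewrite -{1}gv; apply: automorphism_reach.
Qed.

(* If desc(v) is finite and u -> x, an automorphism taking u to x maps the
   finite set desc(u) onto itself, so that u is a descendant of x; hence desc(v)
   is closed under adjacency. *)
Lemma descendants_infinite (G : digraph) (v : G) :
  highly_arc_transitive G -> connected G -> infinite_set [set: G] ->
  infinite_set (descendants v).
Proof.
move=> hat conn; apply: contra_not => fin_v.
have trans (x y : G) : exists2 g, automorphism g & g x = y.
  have [g [autg gx _]] := @reach_homogeneous G 0 x x y y hat erefl erefl.
  by exists g.
have fin_desc (u : G) : finite_set (descendants u).
  have [g autg gu] := trans u v.
  have: finite_set (g @^-1` descendants v).
    by apply: finite_preimage => // x y _ _; apply: automorphism_inj.
  apply: sub_finite_set => x ux /=.
  by rewrite -gu; apply: automorphism_descendants.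
have desc_in (u x : G) : arc G u x -> descendants x u.
  move=> ux; have [g autg gu] := trans u x.
  have gx y : descendants u y -> descendants x (g y).
    by move=> /(automorphism_descendants autg); rewrite gu.
  have gD : g @` descendants u = descendants u.
    apply: finite_inj_self => //; first exact: automorphism_inj.
    move=> _ [y /gx xy <-]; apply: descendants_trans xy.
    exact: descendants_arc (descendants_refl u) ux.
  by have [y /gx xy <-] : (g @` descendants u) u
    by rewrite gD; exact: descendants_refl.
apply: sub_finite_set fin_v => w _.
elim: (connected_walk v w conn) => [_|x y _ vx]; first exact: descendants_refl.
case=> [xy _|yx _]; first exact: descendants_arc vx xy.
exact: descendants_trans vx (desc_in _ _ yx).
Qed.

Lemma reach_finite (G : digraph) p k (v : G) :
  (forall u : G, has_out_valency u p) -> finite_set [set w | reach k v w].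
Proof.
move=> outp; elim: k => [|k IH].
  by apply: sub_finite_set (finite_set1 v) => w /= ->.
apply: (@sub_finite_set _ _
  (\bigcup_(u in [set u | reach k v u]) [set w | arc G u w])).
  by move=> w [u vu uw]; exists u.
by apply: bigcup_finite => // u _; apply/finite_setP; exists p; apply: outp.
Qed.

Lemma reach_level (G : digraph) p k l (v w : G) :
  highly_arc_transitive G -> connected G -> infinite_set [set: G] ->
  (forall u : G, has_out_valency u p) ->
  reach k v w -> reach l v w -> k = l.
Proof.
move=> hat conn inf outp.
wlog kl : k l / k < l => [H|] vwk vwl.
  by case: (ltngtP k l) => // ?; [|symmetry]; apply: H.
(* By [reach_exchange] a vertex at level [l] also lies at level [k], so a walk arriving at level [l]
   can be recounted from [k]. All descendants then lie in the finitely many finite levels below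
   [l]. *)
have bound n (x : G) : reach n v x -> exists2 m, m < l & reach m v x.
  elim: n x => [x <-|n IH x [y /IH[m ml vy] yx]].
    by exists 0 => //; apply: leq_ltn_trans kl.
  have vx : reach m.+1 v x by exists y.
  have /predU1P[ml1|] : (m.+1 == l) || (m.+1 < l) by rewrite -leq_eqVlt.
    by exists k => //; apply: reach_exchange vwl vwk _; rewrite // -ml1.
  by exists m.+1.
case: (descendants_infinite (v := v) hat conn inf).
apply: (@sub_finite_set _ _ (\bigcup_(m in `I_l) [set w | reach m v w])).
  by move=> x /descendantsP[n /bound[m ml vx]]; exists m.
by apply: bigcup_finite (finite_II l) _ => m _; apply: reach_finite.
Qed.

Lemma reach_exists (G : digraph) p k (v : G) : 0 < p ->
  (forall u : G, has_out_valency u p) -> exists w, reach k v w.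
Proof.
move=> p_gt0 outp; elim: k => [|k [w vw]]; first by exists v.
have [s [_ ss sP]] := card_enum (outp w).
case: s ss sP => [ps|x s _ sP]; first by rewrite -ps in p_gt0.
by exists x, w => //; apply/sP/mem_head.
Qed.

(** * Numbers of parents and sizes of levels *)

Definition parents (G : digraph) k (v w : G) : set G :=
  [set u | reach k v u /\ arc G u w].

Lemma card_parents (G : digraph) k (v w v' w' : G) c :
  highly_arc_transitive G -> reach k.+1 v w -> reach k.+1 v' w' ->
  parents k v w #= `I_c -> parents k v' w' #= `I_c.
Proof.
move=> hat vw vw' cvw.
have le (x y x' y' : G) : reach k.+1 x y -> reach k.+1 x' y' ->
    parents k x y #<= parents k x' y'.
  move=> xy xy'; have [g [autg gx gy]] := reach_homogeneous hat xy xy'.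
  have ginj := automorphism_inj autg.
  rewrite -(card_le_eql (inj_card_eq (in2W ginj))).
  apply: subset_card_le => _ [u [xu uy] <-]; split.
    by rewrite -gx; apply: automorphism_reach.
  by rewrite -gy; apply: (autg.2 u y).1.
apply: card_eq_trans cvw; rewrite card_eq_le.
by rewrite !le.
Qed.

Lemma card_reachS (G : digraph) k p (v w : G) d d' c :
  highly_arc_transitive G -> (forall u : G, has_out_valency u p) ->
  [set x | reach k v x] #= `I_d -> [set x | reach k.+1 v x] #= `I_d' ->
  reach k.+1 v w -> parents k v w #= `I_c -> d * p = d' * c.
Proof.
move=> hat outp Dk DSk vw cw; apply: (double_count Dk DSk (e := arc G)).
  move=> u /= vu; rewrite (_ : mkset _ = [set x | arc G u x]); first exact: outp.
  by apply/seteqP; split=> [x []|x ux] //=; split=> //; exists u.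
by move=> x /= vx; apply: card_parents vw vx cw.
Qed.

Lemma card_parents_exists (G : digraph) p k (v w : G) :
  (forall u : G, has_out_valency u p) ->
  exists c, parents k v w #= `I_c.
Proof.
move=> outp; apply/finite_setP; apply: sub_finite_set (reach_finite k v outp).
by move=> u [].
Qed.

Lemma card_reach_dvdn (G : digraph) p k (v : G) :
  0 < p -> highly_arc_transitive G -> (forall u : G, has_out_valency u p) ->
  exists2 d, [set x | reach k v x] #= `I_d & d %| p ^ k.
Proof.
move=> p_gt0 hat outp; elim: k => [|k [d Dk dk]].
  exists 1 => //; rewrite (_ : mkset _ = [set v]); first exact: card_set1.
  by apply/seteqP; split=> x /=.
have [w vw] := reach_exists k.+1 v p_gt0 outp.
have [c cw] := card_parents_exists k v w outp.
have /finite_setP[d' DSk] := reach_finite k.+1 v outp.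
exists d' => //; apply: (@dvdn_trans (d' * c)); first exact: dvdn_mulr.
by rewrite -(card_reachS hat outp Dk DSk vw cw) expnSr dvdn_mul.
Qed.

(** The number [c] of parents divides [p ^ k.+1] and is at most the in-valency [p], so it is 1 or
    [p]. Two distinct parents exclude 1, and [p] parents exhaust the in-neighbours. *)
Lemma parents_dichotomy (G : digraph) p k (v w u u' : G) :
  prime p -> highly_arc_transitive G ->
  (forall x : G, has_in_valency x p) -> (forall x : G, has_out_valency x p) ->
  parents k v w u -> parents k v w u' -> u <> u' ->
  forall x, arc G x w -> reach k v x.
Proof.
move=> p_prime hat inp outp wu wu' neq_uu' x xw.
have p_gt0 := prime_gt0 p_prime.
have vw : reach k.+1 v w by case: wu => vu uw; exists u.
have [c cw] := card_parents_exists k v w outp.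
have [d Dk dk] := card_reach_dvdn k v p_gt0 hat outp.
have [d' DSk _] := card_reach_dvdn k.+1 v p_gt0 hat outp.
have c_dvd : c %| p ^ k.+1.
  apply: (@dvdn_trans (d' * c)); first exact: dvdn_mull.
  by rewrite -(card_reachS hat outp Dk DSk vw cw) expnSr dvdn_mul.
have par_sub : parents k v w `<=` [set y | arc G y w] by move=> y [].
have c_le : c <= p.
  have := subset_card_le par_sub.
  by rewrite (card_le_eql cw) (card_le_eqr (inp w)) card_le_II.
have /(dvdn_pfactor _ _ p_prime)[j _ cj] := c_dvd.
(* Writing [p] as [p ^ 1] turns the bound on [c] into [j <= 1]. *)
move: c_le cw; rewrite {}cj -{2}[p]expn1 leq_exp2l ?prime_gt1 //.
case: j => [_|[_|//]] cw.
  have [s [_ ss sP]] := card_enum cw.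
  case: s ss sP => [|y [|]] // _ sP; case: neq_uu'.
  have y_only x' : parents k v w x' -> x' = y.
    by move=> /sP; rewrite mem_seq1 => /eqP.
  by rewrite (y_only u) // (y_only u').
have: [set y | arc G y w] x by [].
by rewrite -(sub_card_eq par_sub cw (inp w)) => -[].
Qed.

(** * Descendant trees *)

(** Keeps the two neighbours of a vertex on a cycle apart. The cases tell at which of the two steps,
    if any, the successor wraps around. *)
Lemma ordSS_neq n (i : 'I_n) : 2 < n -> ordS (ordS i) != i.
Proof.
move=> n_gt2; apply/eqP => /(congr1 val) /=; case: i => i /= i_n.
have /predU1P[in1|i1n] : (i.+1 == n) || (i.+1 < n) by rewrite -leq_eqVlt.
  by rewrite in1 modnn modn_small //; lia.
have /predU1P[in2|i2n] : (i.+2 == n) || (i.+2 < n) by rewrite -leq_eqVlt.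
  by rewrite (modn_small i1n) in2 modnn; lia.
by rewrite !modn_small //; lia.
Qed.

Section Levelled.
Variables (D : digraph) (lev : D -> nat).
Hypothesis levS : forall x y, arc D x y -> lev y = (lev x).+1.
Hypothesis parent_inj : forall x y z, arc D x z -> arc D y z -> x = y.

(** An arc out of [z] would lead to a higher level, so both neighbours are parents of [z]. *)
Lemma peak_inj x y z :
  adj x z -> adj y z -> lev x <= lev z -> lev y <= lev z -> x = y.
Proof.
move=> [xz|/levS zx] [yz|/levS zy]; rewrite ?zx ?zy ?ltnn //.
by move=> _ _; apply: parent_inj xz yz.
Qed.

(* A vertex of maximal level on a cycle would have two parents. *)
Lemma levelled_no_cycle n (c : 'I_n -> D) : ~ is_cycle c.
Proof.
move=> [n_gt2 c_inj cadj].
have i0 : 'I_n by exists 0; lia.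
have [i _ imax] := arg_maxnP (fun i => lev (c i)) (erefl : xpredT i0).
have cpred := cadj (ord_pred i); rewrite ord_predK in cpred.
have /c_inj eq_i := peak_inj (adj_sym (cadj i)) cpred (imax _ isT) (imax _ isT).
by have /eqP := ordSS_neq i n_gt2; rewrite eq_i ord_predK.
Qed.

(** A highest vertex inside the path would have two equal neighbours by [peak_inj], and the start
    has level 0, below [y]. So the highest vertex is [y], and the vertex before it on the path is
    its only parent [x]. *)
Lemma levelled_directed_away (r : D) : lev r = 0 -> directed_away r.
Proof.
move=> r0 x y xy [|k] a [a_inj aadj] a0 ak.
  by have := levS xy; rewrite -ak [ord_max]ord1 a0 r0.
have [i _ imax] := arg_maxnP (fun i => lev (a i)) (erefl : xpredT ord0).
have i_gt0 : 0 < i.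
  rewrite lt0n; apply: contraPneq (imax ord_max isT) => i0.
  have -> : i = ord0 by apply/val_inj.
  by rewrite a0 ak r0 (levS xy).
have prev : i = (inord i.-1 : 'I_k.+2).+1 :> nat.
  by rewrite inordK ?prednK //; have := ltn_ord i; lia.
have [ik|ik] := eqVneq i ord_max.
  exists (inord i.-1) => //; apply/esym; apply: (@peak_inj _ _ y).
  - by left.
  - by rewrite -ak -ik; apply: aadj.
  - by rewrite (levS xy).
  - by rewrite -ak -ik; apply: imax.
have lt_ik : i < k.+1.
  have := ltn_ord i; rewrite ltnS leq_eqVlt => /orP[/eqP ik'|//].
  by case/eqP: ik; apply/val_inj.
have next : (inord i.+1 : 'I_k.+2) = i.+1 :> nat by rewrite inordK.
have /a_inj/(congr1 val) := peak_inj (aadj _ _ prev) (adj_sym (aadj _ _ next))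
  (imax _ isT) (imax _ isT).
by rewrite /= next; lia.
Qed.

End Levelled.

Lemma descendants_tree (G : digraph) (p : nat) (v : G) :
  highly_arc_transitive G -> connected G -> infinite_set [set: G] ->
  (forall u : G, has_out_valency u p) ->
  (forall k (w u u' : G), parents k v w u -> parents k v w u' -> u = u') ->
  rooted_tree (descendant_root v) p.
Proof.
move=> hat conn inf outp parents_inj.
pose D := descendant_digraph v.
have sval_inj (x y : D) : sval x = sval y -> x = y.
  by case: x y => [x dx] [y dy] /= exy; apply: eq_exist.
have /choice[lev levP] (x : D) : exists k, reach k v (sval x).
  by apply/descendantsP; exact: (svalP x).
have lev_eq k (x : D) : reach k v (sval x) -> lev x = k.
  exact: reach_level (levP x).
have levS (x y : D) : arc D x y -> lev y = (lev x).+1.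
  by move=> xy; apply: lev_eq; exists (sval x).
have parent_inj (x y z : D) : arc D x z -> arc D y z -> x = y.
  move=> xz yz; apply/sval_inj/(parents_inj (lev x) (sval z)); split=> //.
  by have [->] : (lev x).+1 = (lev y).+1 by rewrite -(levS _ _ xz) (levS _ _ yz).
(* Every vertex of a k-arc from [v] is a descendant, so the walk stays in the induced digraph. *)
have walk_root (x : D) : walk setT (descendant_root v : D) x.
  move: (lev x) (levP x) => k; elim: k x => [|k IH] x.
    move=> /= vx; have -> : x = descendant_root v by apply: sval_inj.
    exact: walk_refl.
  case=> y vy yx.
  have dy : descendants v y by apply/descendantsP; exists k.
  by apply: (walk_step (IH (exist _ y dy) vy)) => //; left.
split; first split.
- move=> x y.
  have [k [a [apath a0 ak _]]] :=
    walk_path (walk_trans (walk_sym (walk_root x)) (walk_root y)).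
  by exists k, a.
- by move=> x /levS; lia.
- exact: levelled_no_cycle levS parent_inj.
- by apply: levelled_directed_away levS parent_inj _ _; apply: lev_eq.
- move=> x; apply: card_eq_trans (outp (sval x)).
  have sval_in : {in [set y | arc D x y] &, injective (@sval _ (descendants v))}.
    by move=> y z _ _; apply: sval_inj.
  rewrite -(card_eql (inj_card_eq sval_in)).
  rewrite (_ : _ @` _ = [set y | arc G (sval x) y]) //.
  apply/seteqP; split=> [_ [y xy <-] //|y xy].
  have dy : descendants v y by apply: descendants_arc xy; apply: (svalP x).
  by exists (exist _ y dy).
Qed.

(** * Two-ended digraphs *)

Lemma finite_nat_ub (A : set nat) :
  finite_set A -> exists n, forall i, A i -> i < n.
Proof.
move=> /finite_setP[m /card_enum[s [_ _ sP]]].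
exists (\max_(i <- s) i).+1 => i /sP si; rewrite ltnS.
exact: (@leq_bigmax_seq _ s xpredT id).
Qed.

Lemma inj_eventually_out (T : Type) (r : nat -> T) (A : set T) :
  injective r -> finite_set A -> exists n0, forall n, n0 <= n -> ~ A (r n).
Proof.
move=> r_inj finA.
have /finite_nat_ub[n0 rA] : finite_set (r @^-1` A).
  by apply: finite_preimage => // x y _ _; apply: r_inj.
by exists n0 => n n0n /rA; lia.
Qed.

(* [h] plays the role of the index i of the finite sets S_i; the last clause
   makes any two rays going the same way meet along arbitrarily remote paths. *)
Definition quasi_line (G : digraph) (h : G -> int) (K : int) : Prop :=
  [/\ forall u v, adj u v -> (h v <= h u + 1)%R,
      forall i, finite_set [set x | h x = i]
    & forall x y, h x = h y -> walk [set w | (`|h w - h x| <= K)%R] x y].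

Definition tends_up (G : digraph) (h : G -> int) (r : nat -> G) : Prop :=
  forall N : int, exists n0, forall n, n0 <= n -> (N <= h (r n))%R.

(** Exchanges the two directions, so that facts on rays tending up apply to rays tending down. *)
Lemma quasi_line_opp (G : digraph) (h : G -> int) K :
  quasi_line h K -> quasi_line (fun x => - h x)%R K.
Proof.
move=> [h_adj h_fin h_walk]; split=> [u v /adj_sym/h_adj|i|x y hxy].
- by lia.
- by apply: sub_finite_set (h_fin (- i)%R) => x /=; lia.
have /h_walk : h x = h y by lia.
by apply: walkW => w /=; lia.
Qed.

(** Discrete intermediate values: [h] rises by at most 1 at each step and cannot jump over [M]. *)
Lemma tends_up_hits (G : digraph) (h : G -> int) K (r : nat -> G) M :
  quasi_line h K -> is_ray r -> tends_up h r -> (h (r 0%N) <= M)%R ->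
  exists n, h (r n) = M.
Proof.
move=> [h_adj _ _] [_ r_adj] r_up r0M.
have [n /(_ _ (leqnn n))] := r_up M.
elim: n => [|n IH] Mn; first by exists 0; lia.
have := h_adj _ _ (r_adj n).
case: (boolP (M <= h (r n))%R) => [/IH + _|nM le_n]; [by []|exists n.+1; lia].
Qed.

Lemma tends_up_link (G : digraph) (h : G -> int) K (r s : nat -> G) (N : int) :
  quasi_line h K -> is_ray r -> is_ray s -> tends_up h r -> tends_up h s ->
  exists (k : nat) (a : 'I_k.+1 -> G),
    [/\ is_path a, range r (a ord0), range s (a ord_max)
      & forall i, (N < h (a i))%R].
Proof.
move=> hK ray_r ray_s up_r up_s.
(* Both rays start below [M] and so pass through it; a walk straying at most [K] from [M] stays
   above [N]. *)
pose M : int := (`|N| + `|K| + `|h (r 0)%N| + `|h (s 0)%N| + 1)%R.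
have [i ri] : exists i, h (r i) = M.
  by apply: (tends_up_hits hK ray_r up_r); rewrite /M; lia.
have [j sj] : exists j, h (s j) = M.
  by apply: (tends_up_hits hK ray_s up_s); rewrite /M; lia.
have [_ _ /(_ (r i) (s j))] := hK; rewrite ri sj => /(_ erefl)/walk_path.
move=> [k [a [apath a0 ak aM]]]; exists k, a; split=> //.
- by rewrite a0; exists i.
- by rewrite ak; exists j.
- by move=> l; have := aM l; rewrite /= /M; lia.
Qed.

Lemma ord_ub k (f : 'I_k -> int) : exists B : int, forall i, (f i <= B)%R.
Proof.
exists (\max_(i < k) `|f i|%N)%:Z%R => i.
have := @leq_bigmax _ (fun i => `|f i|%N) i; rewrite /=; lia.
Qed.

Lemma tends_up_equiv (G : digraph) (h : G -> int) K (r s : nat -> G) :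
  quasi_line h K -> is_ray r -> is_ray s -> tends_up h r -> tends_up h s ->
  ray_equiv r s.
Proof.
move=> hK ray_r ray_s up_r up_s.
have /choice[F FP] (N : int) : exists P : {k & 'I_k.+1 -> G} * int,
    [/\ is_path (projT2 P.1), range r (projT2 P.1 ord0),
        range s (projT2 P.1 ord_max)
      & forall i, (N < h (projT2 P.1 i) <= P.2)%R].
  have [k [a [apath a0 ak aN]]] := tends_up_link N hK ray_r ray_s up_r up_s.
  have [B aB] := ord_ub (h \o a).
  exists (existT _ k a, B); split=> //= i; rewrite aN; exact: aB.
(* The upper bound stored with each path is the lower bound for the next one, so the paths have
   disjoint ranges of [h]. *)
pose N m := iter m (fun N => (F N).2) 0%R.
have N_lt m : (N m < N m.+1)%R.
  by have [_ _ _ /(_ ord0)/andP[]] := FP (N m); rewrite /=; lia.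
have N_le m n : m <= n -> (N m <= N n)%R.
  elim: n => [|n IH]; first by rewrite leqn0 => /eqP->.
  by rewrite leq_eqVlt => /predU1P[-> //|/IH]; have := N_lt n; lia.
exists (fun m => projT1 (F (N m)).1), (fun m => projT2 (F (N m)).1); split.
  by move=> m; have [] := FP (N m).
have disj m n : m < n ->
    range (projT2 (F (N m)).1) `&` range (projT2 (F (N n)).1) = set0.
  move=> /N_le mn; apply/seteqP; split=> // _ [[i _ <-] [j _ eq_ij]].
  have [_ _ _ /(_ i)] := FP (N m); have [_ _ _ /(_ j)] := FP (N n).
  by move: mn; rewrite eq_ij /=; lia.
apply/trivIsetP => m n _ _.
by case: ltngtP => // mn _; [exact: disj|rewrite setIC; exact: disj].
Qed.

Lemma finite_levels (G : digraph) (h : G -> int) K (N : nat) :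
  quasi_line h K -> finite_set [set x | (`|h x| <= N%:Z)%R].
Proof.
move=> [_ h_fin _].
apply: (@sub_finite_set _ _
  (\bigcup_(i in `I_(N + N).+1) [set x | h x = (i%:Z - N%:Z)%R])).
  by move=> x /= hx; exists (absz (h x + N%:Z)%R) => /=; lia.
by apply: bigcup_finite (finite_II _) _.
Qed.

(** A ray leaves each finite set [|h| <= N] for good. Once it has left level 0, the sign of [h] is
    constant, since [h] changes by at most 1 per step. *)
Lemma ray_tends (G : digraph) (h : G -> int) K (r : nat -> G) :
  quasi_line h K -> is_ray r -> tends_up h r \/ tends_up (fun x => - h x)%R r.
Proof.
move=> hK [r_inj r_adj]; have [h_adj _ _] := hK.
have out (N : nat) : exists n0, forall n, n0 <= n -> (N%:Z < `|h (r n)|)%R.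
  have [n0 Hn] := inj_eventually_out r_inj (finite_levels N hK).
  by exists n0 => n /Hn /=; lia.
have [n0 n0P] := out 0.
have step n : n0 <= n -> (0 < h (r n))%R = (0 < h (r n0))%R.
  elim: n => [|n IH]; first by rewrite leqn0 => /eqP->.
  rewrite leq_eqVlt => /predU1P[-> //|n0n]; rewrite -IH //.
  have := n0P n n0n; have := n0P n.+1 (leqW n0n).
  have := h_adj _ _ (r_adj n); have := h_adj _ _ (adj_sym (r_adj n)); lia.
have [pos|neg] := boolP (0 < h (r n0))%R; [left|right] => N;
  have [n1 n1P] := out `|N|%N; exists (maxn n0 n1) => n; rewrite geq_max;
  move=> /andP[/step + /n1P]; lia.
Qed.

Lemma opposite_not_equiv (G : digraph) (h : G -> int) K (r s : nat -> G) :
  quasi_line h K -> tends_up h r -> tends_up (fun x => - h x)%R s ->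
  ~ ray_equiv r s.
Proof.
move=> [h_adj h_fin _] up_r up_s [len [P [Ppath /trivIsetP Pdisj]]].
have [n0 n0P] := up_r 0%R; have [n1 n1P] := up_s 0%R.
(* Every linking path meets this finite set: an endpoint lies on an initial segment of a ray, or the
   path runs from [h >= 0] to [h <= 0] and crosses level 0. Disjoint paths would give infinitely
   many points of [F]. *)
pose F := [set x | h x = 0%R] `|` r @` `I_n0 `|` s @` `I_n1.
have finF : finite_set F.
  by rewrite !finite_setU; do !split;
    [exact: h_fin | exact/finite_image/finite_II..].
have meets m : exists x, range (P m) x /\ F x.
  have [[_ a_adj] [i _ ri] [j _ sj]] := Ppath m.
  have [i_lt|i_ge] := ltnP i n0.
    by exists (P m ord0); split; [exists ord0|left; right; exists i].
  have [j_lt|j_ge] := ltnP j n1.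
    by exists (P m ord_max); split; [exists ord_max|right; exists j].
  have h0 : (0 <= h (P m ord0))%R by rewrite -ri n0P.
  have hk : (h (P m ord_max) <= 0)%R by have := n1P _ j_ge; rewrite -sj; lia.
  suff [l hl] : exists l, h (P m l) = 0%R.
    by exists (P m l); split; [exists l|left; left].
  have max_inord : ord_max = inord (len m) :> 'I_(len m).+1.
    by apply/val_inj; rewrite /= inordK.
  rewrite {}max_inord in hk.
  suff descend l : l <= len m -> (h (P m (inord l)) <= 0)%R ->
    exists l, h (P m l) = 0%R by exact: descend (leqnn _) hk.
  elim: l => [_ hl|l IH l_le hl].
    exists ord0; have inord0 : inord 0 = ord0 :> 'I_(len m).+1.
      by apply/val_inj; rewrite /= inordK.
    by rewrite inord0 in hl; lia.
  have [/(IH (ltnW l_le)) //|pos] := boolP (h (P m (inord l)) <= 0)%R.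
  exists (inord l.+1).
  have lS : (inord l.+1 : 'I_(len m).+1) = (inord l : 'I_(len m).+1).+1 :> nat.
    by rewrite !inordK // ltnS ltnW.
  by have := h_adj _ _ (adj_sym (a_adj _ _ lS)); lia.
have {meets}/choice[f fP] := meets.
have f_inj : injective f.
  move=> m n fmn; apply/eqP/negP => /negP mn.
  have [[fm _] [fn _]] := (fP m, fP n).
  suff : (range (P m) `&` range (P n)) (f m) by rewrite Pdisj.
  by split=> //; rewrite fmn.
apply: infinite_nat; apply: (@sub_finite_set _ _ (f @^-1` F)).
  by move=> m _; have [] := fP m.
by apply: finite_preimage => // x y _ _; apply: f_inj.
Qed.

Lemma card_set2 (T : Type) (x y : T) : x <> y -> [set x; y] #= `I_2.
Proof.
move=> xy; rewrite card_eq_sym.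
pose f (n : nat) := if n is 0 then x else y.
have f_in : {in `I_2 &, injective f}.
  move=> [|[|n]] [|[|m]]; rewrite !inE //= => _ _ // exy; case: xy => //.
rewrite -(card_eql (inj_card_eq f_in)) (_ : f @` `I_2 = [set x; y]) //.
apply/seteqP; split=> [_ [[|[|//]] _ <-]|z [->|->]]; [by left|by right| |].
- by exists 0.
- by exists 1.
Qed.

(** The ends are the rays tending up and those tending down: [ray_tends] leaves no others,
    [tends_up_equiv] joins rays of one direction, and [opposite_not_equiv] separates the
    directions. *)
Lemma quasi_line_two_ends (G : digraph) (h : G -> int) K (r s : nat -> G) :
  quasi_line h K -> is_ray r -> is_ray s ->
  tends_up h r -> tends_up (fun x => - h x)%R s -> ends G #= `I_2.
Proof.
move=> hK ray_r ray_s up_r up_s.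
have hK' := quasi_line_opp hK.
pose U := [set t | is_ray t /\ tends_up h t].
pose D := [set t | is_ray t /\ tends_up (fun x => - h x)%R t].
have oppK : (fun x => - - h x)%R = h by apply/funext => x; lia.
have class_up t : is_ray t -> tends_up h t ->
    [set t' | is_ray t' /\ ray_equiv t t'] = U.
  move=> ray_t up_t; apply/seteqP; split=> t' [ray_t' tt']; split=> //.
    by case: (ray_tends hK ray_t') => // /(opposite_not_equiv hK up_t).
  exact: tends_up_equiv hK _ _ _ _.
have class_down t : is_ray t -> tends_up (fun x => - h x)%R t ->
    [set t' | is_ray t' /\ ray_equiv t t'] = D.
  move=> ray_t up_t; apply/seteqP; split=> t' [ray_t' tt']; split=> //.
    case: (ray_tends hK ray_t') => // up_t'.
    by case: (opposite_not_equiv hK' up_t _ tt'); rewrite oppK.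
  exact: tends_up_equiv hK' _ _ _ _.
have UD : U <> D.
  move=> eqUD; have [_ down_r] : D r by rewrite -eqUD.
  by case: (opposite_not_equiv hK up_r down_r (tends_up_equiv hK _ _ _ _)).
rewrite (_ : ends G = [set U; D]); first exact: card_set2.
apply/seteqP; split=> [_ [t ray_t <-]|_ [->|->]].
- by case: (ray_tends hK ray_t) => ?;
    [left; apply: class_up|right; apply: class_down].
- by exists r => //; apply: class_up.
- by exists s => //; apply: class_down.
Qed.

(** * Levels that stop growing *)

(** Automorphisms carry the property from [v], [w] to all pairs at level [K.+1]. For larger [k] the
    first arc of the walk is dropped and the induction hypothesis applied at its head. *)
Lemma parents_propagate (G : digraph) K (v w : G) :
  highly_arc_transitive G ->
  reach K.+1 v w -> (forall x, arc G x w -> reach K v x) ->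
  forall k v' w' x, K <= k -> reach k.+1 v' w' -> arc G x w' -> reach k v' x.
Proof.
move=> hat vw vw_par k v' w' x /subnKC <-.
elim: (k - K) v' => [|t IH] v'.
  rewrite addn0 => vw' xw'; have [g [autg gv gw]] := reach_homogeneous hat vw vw'.
  have [[f _ gK] garc] := autg; rewrite -gv -(gK x).
  by apply: automorphism_reach (autg) _; apply/vw_par/garc; rewrite gK gw.
rewrite addnS => /(@reach_split _ 1)[u [_ <- vu] uw] xw.
exact: reachSl vu (IH u uw xw).
Qed.

Lemma card_reach_eq (G : digraph) k (v v' : G) :
  highly_arc_transitive G -> [set x | reach k v x] #= [set x | reach k v' x].
Proof.
move=> hat.
have le (x y : G) : [set z | reach k x z] #<= [set z | reach k y z].
  have [g [autg gx _]] := @reach_homogeneous G 0 x x y y hat erefl erefl.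
  rewrite -(card_le_eql (inj_card_eq (in2W (automorphism_inj autg)))).
  apply: subset_card_le => _ [z xz <-] /=.
  by rewrite -gx; apply: automorphism_reach.
by rewrite card_eq_le !le.
Qed.

Lemma reach_absorb (G : digraph) p K :
  0 < p -> highly_arc_transitive G ->
  (forall x : G, has_in_valency x p) -> (forall x : G, has_out_valency x p) ->
  (forall v w x : G, reach K.+1 v w -> arc G x w -> reach K v x) ->
  forall u v w : G, arc G u v -> reach K.+1 u w -> reach K v w.
Proof.
move=> p_gt0 hat inp outp par u v w uv uw.
have [d Dk _] := card_reach_dvdn K u p_gt0 hat outp.
have [d' DSk _] := card_reach_dvdn K.+1 u p_gt0 hat outp.
have par_w : parents K u w #= `I_p.
  rewrite (_ : parents K u w = [set x | arc G x w]); first exact: inp.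
  by apply/seteqP; split=> [x []|x xw] //; split=> //; apply: par xw.
(* As each vertex has [p] parents, the factor [p] cancels and levels [K] and [K.+1] have equal
   size. *)
have /eqP := card_reachS hat outp Dk DSk uw par_w.
rewrite eqn_pmul2r // => /eqP eq_d; rewrite -eq_d in DSk.
have : [set x | reach K.+1 u x] w by [].
rewrite -(sub_card_eq _ (card_eq_trans (card_reach_eq K v u hat) Dk) DSk) //.
by move=> x; apply: reachSl.
Qed.

(** Absorption is applied at each arc from [u] to [z]. This yields, for two vertices of one S_i, a
    common vertex [K] steps before both. *)
Lemma reach_absorb_iter (G : digraph) K t (u z w : G) :
  (forall u v w : G, arc G u v -> reach K.+1 u w -> reach K v w) ->
  reach (t + K) u w -> reach t u z -> reach K z w.
Proof.
move=> absorb; elim: t u => [|t IH] u; first by move=> uw <-.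
rewrite addSn addnC -addSn => /reach_split[x ux xw].
move=> /(@reach_split _ 1)[v [_ <- uv] vz].
apply: IH vz; rewrite addnC.
exact: reach_trans (absorb _ _ _ uv ux) xw.
Qed.

Lemma walk_reach (G : digraph) (h : G -> int) k (z x : G) :
  (forall x y, arc G x y -> h y = (h x + 1)%R) ->
  reach k z x ->
  h x = (h z + k%:Z)%R /\ walk [set w | (h z <= h w <= h z + k%:Z)%R] z x.
Proof.
move=> h_arc; elim: k x => [x <-|k IH x [y /IH[hy zy] yx]].
  by split; [lia|apply: walk_refl => /=; lia].
have hx := h_arc _ _ yx; split; first lia.
apply: walk_step (walkW _ zy) _ _; [move=> w /=; lia|by left|rewrite /=; lia].
Qed.

Lemma thin_two_ended (G : digraph) p K :
  0 < p -> infinite_set [set: G] -> highly_arc_transitive G -> connected G ->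
  (forall x : G, has_in_valency x p) -> (forall x : G, has_out_valency x p) ->
  (forall k (v w x : G),
     K <= k -> reach k.+1 v w -> arc G x w -> reach k v x) ->
  (forall u v w : G, arc G u v -> reach K.+1 u w -> reach K v w) ->
  two_ended G.
Proof.
move=> p_gt0 inf hat conn inp outp par absorb; split=> //.
have [b _] := infinite_setN0 inf.
have /choice[prev prevP] (v : G) : exists u, arc G u v.
  have [s [_ ss sP]] := card_enum (inp v).
  case: s ss sP => [ps|x s _ sP]; first by rewrite -ps in p_gt0.
  by exists x; apply/sP/mem_head.
have /choice[next nextP] (v : G) : exists u, arc G v u.
  have [u [_ <- vu]] := reach_exists 1 v p_gt0 outp.
  by exists u.
(* This is D_n(v_{-j}) for the backward ray v_{-j} = [iter j prev b]. By [T_up] and [T_down] it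
   depends only on [n - j] once [K <= n]. *)
pose T j n x := reach n (iter j prev b) x.
have T_up m j n x : T j n x -> T (m + j) (m + n) x.
  elim: m => // m IH /IH; apply: reachSl; exact: prevP.
have T_down m j n x : K <= n -> T (m + j) (m + n) x -> T j n x.
  move=> Kn; elim: m => // m IH Tx; apply: IH.
  move: Tx; rewrite /T (_ : m.+1 + n = K.+1 + (m + n - K)); last by lia.
  move=> /reach_split[y /(absorb _ _ _ (prevP _)) uy yx].
  rewrite (_ : m + n = K + (m + n - K)); last by lia.
  exact: reach_trans uy yx.
(* Membership of [x] in S_i. *)
pose rep x (i : int) := exists j n, [/\ K <= n, i = (n%:Z - j%:Z)%R & T j n x].
have rep_arc x y i : arc G x y -> rep x i -> rep y (i + 1)%R.
  move=> xy [j [n [Kn -> Tx]]]; exists j, n.+1.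
  by split; [exact: leqW|lia|exists x].
have rep_arcV x y i : arc G y x -> rep x i -> rep y (i - 1)%R.
  move=> yx [j [n [Kn -> Tx]]]; exists j.+1, n.
  (* Seen from the base one step further back, [x] is at level [n.+1], so [par] puts [y] at level
     [n]. *)
  by split=> //; [lia|apply: par yx => //; apply: (T_up 1)].
have rep_T x i J N : rep x i -> K <= N -> i = (N%:Z - J%:Z)%R -> T J N x.
  move=> [j [n [Kn -> Tx]]] KN eq_i; apply: (T_down j) => //.
  by rewrite addnC (_ : j + N = J + n); [apply: T_up|lia].
(* From the common base of index [j + j'], [x] is at levels [j' + n] and [j + n'], which agree by
   [reach_level]. *)
have rep_inj x i i' : rep x i -> rep x i' -> i = i'.
  move=> [j [n [Kn -> Tx]]] [j' [n' [Kn' -> Tx']]].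
  have := T_up j' _ _ _ Tx; rewrite addnC => Tx1.
  by have := reach_level hat conn inf outp Tx1 (T_up j _ _ _ Tx'); lia.
(* Indices spread by connectedness from a vertex [c] at level [K] of [b], whose index is [K]. *)
have /choice[h hP] x : exists i, rep x i.
  have [c bc] := reach_exists K b p_gt0 outp.
  elim: (connected_walk c x conn) => [_|y z _ [i yi] yz _].
    by exists (K%:Z)%R, 0, K; split=> //; lia.
  by case: yz => [/rep_arc|/rep_arcV] /(_ _ yi);
    [exists (i + 1)%R|exists (i - 1)%R].
have h_arc x y : arc G x y -> h y = (h x + 1)%R.
  by move=> xy; apply: rep_inj (hP y) _; apply: rep_arc xy (hP x).
have h_T x N : K <= N -> (h x <= N%:Z)%R -> T `|(N%:Z - h x)%R|%N N x.
  by move=> KN hN; apply: rep_T (hP x) KN _; lia.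
have hQL : quasi_line h (K%:Z)%R.
  split=> [u v [/h_arc|/h_arc]|i|x y hxy]; [lia|lia| |].
    (* S_i lies in level [N] of a single vertex of the backward ray, as [N] is at least [K] and
       [i]. *)
    pose N := K + `|i|%N.
    apply: sub_finite_set
      (reach_finite N (iter `|(N%:Z - i)%R|%N prev b) outp).
    by move=> x /= hx; have := @h_T x N; rewrite hx; apply; lia.
  pose N := K + `|h x|%N.
  (* The extra [K] steps provide a vertex [z] at level [N] from which both [x] and [y] are reached
     in [K] steps; the walk through [z] keeps [h] between [h x - K] and [h x]. *)
  pose M := N + K.
  have Tx : T `|(M%:Z - h x)%R|%N M x by apply: h_T; lia.
  have Ty : T `|(M%:Z - h x)%R|%N M y by rewrite hxy; apply: h_T; lia.
  have [z Tz zx] := reach_split Tx.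
  have zy := reach_absorb_iter absorb Ty Tz.
  have [hx zx_walk] := walk_reach h_arc zx.
  have [hy zy_walk] := walk_reach h_arc zy.
  apply: (walk_trans (walk_sym (walkW _ zx_walk)) (walkW _ zy_walk)) => w /=; lia.
(* Strict monotonicity of [h] makes the forward and backward sequences from [b] injective, hence
   rays. *)
have h_next n : h (iter n next b) = (h b + n%:Z)%R.
  by elim: n => [|n IH] /=; [lia|have := h_arc _ _ (nextP (iter n next b)); lia].
have h_prev n : h (iter n prev b) = (h b - n%:Z)%R.
  by elim: n => [|n IH] /=; [lia|have := h_arc _ _ (prevP (iter n prev b)); lia].
apply: (quasi_line_two_ends (r := fun n => iter n next b)
  (s := fun n => iter n prev b) hQL).
- split=> [m n /(congr1 h)|i]; last by left; apply: nextP.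
  by rewrite !h_next; lia.
- split=> [m n /(congr1 h)|i]; last by right; apply: prevP.
  by rewrite !h_prev; lia.
- by move=> N; exists `|(N - h b)%R|%N => n; rewrite h_next; lia.
- by move=> N; exists `|(N + h b)%R|%N => n; rewrite h_prev; lia.
Qed.

Theorem theorem19 (G : digraph) (p : nat)
  (Ginf : infinite_set [set: G])
  (Ghat : highly_arc_transitive G)
  (Gconn : connected G)
  (p_prime : prime p)
  (Gin : forall v : G, has_in_valency v p)
  (Gout : forall v : G, has_out_valency v p) :
  two_ended G \/ forall v : G, rooted_tree (descendant_root v) p.
Proof.
have p_gt0 := prime_gt0 p_prime.
have [[v [k [w [u [u' [wu wu' uu']]]]]]|inj] := pselect (exists (v : G) k w u u',
  [/\ parents k v w u, parents k v w u' & u <> u']); last first.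
  right=> v; apply: descendants_tree => // k w u u' wu wu'.
  by apply: contra_notP inj => uu'; exists v, k, w, u, u'.
have vw : reach k.+1 v w by case: wu => vu uw; exists u.
(* The level [k] at which a single vertex has two parents serves as the threshold [K] for all
   vertices. *)
have par := parents_propagate Ghat vw
  (parents_dichotomy p_prime Ghat Gin Gout wu wu' uu').
left; apply: (thin_two_ended p_gt0 Ginf Ghat Gconn Gin Gout par).
by apply: (reach_absorb p_gt0 Ghat Gin Gout) => v' w' x; apply: par.
Qed.
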